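(* Let $\mathbb{X}_{\mathrm{L}}$ be the Ledrappier shift with its Haar probability measure $\mu_{\mathrm{L}}$. For $w\in\mathbb{X}_{\mathrm{L}}$, let $\omega=\omega_w=\sum_{x\in\mathbb{Z}^2} w_x\,\delta_x$ be the attached Dirac comb, regarded as a measure on $\mathbb{R}^2$. Then, for $\mu_{\mathrm{L}}$-almost every $w\in\mathbb{X}_{\mathrm{L}}$, the autocorrelation measure $\gamma$ of $\omega$ exists, and the autocorrelation and diffraction measures of $\omega$ are $$\gamma=\delta_0\quad\text{and}\quad \widehat{\gamma}=\lambda,$$ where $\lambda$ denotes Lebesgue measure on $\mathbb{R}^2$.
   Context: Let $e_1,e_2$ be the standard unit vectors of $\mathbb{Z}^2\subset\mathbb{R}^2$. The Ledrappier shift is $$\mathbb{X}_{\mathrm{L}}=\{w=(w_x)_{x\in\mathbb{Z}^2}\in\{\pm1\}^{\mathbb{Z}^2}\mid w_x\,w_{x+e_1}\,w_{x+e_2}=1\text{ for all }x\in\mathbb{Z}^2\},$$ a closed subgroup (under pointwise multiplication) of the compact Abelian group $\{\pm1\}^{\mathbb{Z}^2}$ with the product topology; $\mu_{\mathrm{L}}$ is its normalised Haar measure. For $N\in\mathbb{N}$ let $C_N=[-N,N]^2\subset\mathbb{R}^2$. For a translation bounded measure $\omega$ on $\mathbb{R}^2$, let $\omega_N$ be its restriction to $C_N$. For a measure $\nu$, let $\widetilde{\nu}(g)=\overline{\nu(\widetilde{g})}$ for continuous compactly supported $g$, where $\widetilde{g}(x)=\overline{g(-x)}$. The autocorrelation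 of $\omega$ is the vague limit $$\gamma=\lim_{N\to\infty}\frac{\omega_N*\widetilde{\omega_N}}{\mathrm{vol}(C_N)},$$ provided that the limit exists. It is then a positive definite measure, hence Fourier transformable, and its Fourier transform $\widehat{\gamma}$ (as a measure on $\mathbb{R}^2$, with the convention $\widehat{g}(k)=\int e^{-2\pi i k\cdot x}g(x)\,dx$, so that $\widehat{\delta_0}=\lambda$ and $\widehat{\delta_{\mathbb{Z}^2}}=\delta_{\mathbb{Z}^2}$) is called the diffraction measure of $\omega$. *)

(* Defs.v *)
(* MathComp / MathComp-Analysis *)
From HB Require Import structures.
From mathcomp Require Import all_boot all_order all_algebra complex.
From mathcomp Require Import all_classical all_reals all_analysis.

Set Implicit Arguments.
Unset Strict Implicit.
Unset Printing Implicit Defensive.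

Import Order.TTheory GRing.Theory Num.Theory.
Import numFieldNormedType.Exports.

Local Open Scope classical_set_scope.
Local Open Scope ring_scope.
Local Open Scope complex_scope.

(* {+1, -1} is encoded by bool, with discrete topology and group law (+), via
   the isomorphism b |-> (-1) ^+ b. *)
Definition spin (A : pzRingType) (b : bool) : A := (-1) ^+ b.

Definition configuration : Type := {ptws (int * int)%type -> bool}.

Definition ledrappier_set : set configuration :=
  [set w | forall x : int * int,
     spin int (w x) * spin int (w (x + (1, 0))) * spin int (w (x + (0, 1))) = 1].

Definition ledrappier : Type := set_type ledrappier_set.

HB.instance Definition _ := Topological.on ledrappier.

Lemma ledrappier_one_subproof :
  ((fun=> false) : configuration) \in ledrappier_set.
Proof. by rewrite inE => x; rewrite /spin !expr0 !mulr1. Qed.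

Definition ledrappier_one : ledrappier := SigSub ledrappier_one_subproof.

HB.instance Definition _ := isPointed.Build ledrappier ledrappier_one.

Lemma ledrappier_mul_subproof (v w : ledrappier) :
  ((fun x => set_val v x (+) set_val w x) : configuration) \in ledrappier_set.
Proof.
rewrite inE => x /=.
have vL : spin int _ * _ * _ = 1 := set_valP v x.
have wL : spin int _ * _ * _ = 1 := set_valP w x.
rewrite /spin !signr_addb (mulrACA (_ ^+ set_val v x)) (mulrACA (_ * _)).
rewrite -!/(spin _ _).
by rewrite vL wL mulr1.
Qed.

Definition ledrappier_mul (v w : ledrappier) : ledrappier :=
  SigSub (ledrappier_mul_subproof v w).

Notation borel T := (g_sigma_algebraType (@open T)).

(* The group is compact metrisable, so every Borel probability measure on it is
   regular, and invariance alone characterises the normalised Haar measure. *)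
Definition is_haar (R : realType) (mu : probability (borel ledrappier) R) :=
  forall (v : ledrappier) (A : set (borel ledrappier)),
    measurable A -> mu (ledrappier_mul v @` A) = mu A.

Section complex_integral.
Context d (T : measurableType d) (R : realType).
Implicit Types (m : {measure set T -> \bar R}) (D : set T) (f : T -> R[i]).

Definition cintegrable m D f :=
  m.-integrable D (EFin \o (@complex.Re R \o f)) /\
  m.-integrable D (EFin \o (@complex.Im R \o f)).

Definition cintegral m D f : R[i] :=
  Rintegral m D (@complex.Re R \o f) +i* Rintegral m D (@complex.Im R \o f).

Lemma cintegrable_realC m D (f : T -> R) :
  measurable D -> (m D < +oo)%E -> measurable_fun D f ->
  [bounded f x | x in D] -> cintegrable m D (fun x => (f x)%:C).
Proof.
move=> mD Doo mf bf; split; first exact: measurable_bounded_integrable.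
exact: integrable0.
Qed.

End complex_integral.

Section measures_on_the_plane.
Variable R : realType.
Local Notation plane := (R * R)%type.
(* The same carrier with the Borel sigma-algebra. *)
Local Notation mplane := (measurableTypeR R * measurableTypeR R)%type.

Definition square (r : R) : set mplane :=
  [set x | `|x.1| <= r /\ `|x.2| <= r].

(* A complex Radon measure h . m, with m a positive Borel measure and h a
   locally m-integrable density.  By polar decomposition every complex Radon
   measure on the plane is of this form (not uniquely). *)
Record radon := Radon {
  radon_base : {measure set mplane -> \bar R};
  radon_density : plane -> R[i];
  radon_locally_integrable :
    forall r : R, cintegrable radon_base (square r) radon_density
}.

Implicit Types (nu : radon) (f g phi : plane -> R[i]).

Definition radon_integrable nu f :=
  cintegrable (radon_base nu) setT (fun x => f x * radon_density nu x).

(* With a measurable set D, [radon_integral nu D] is the restriction of nu to D,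
   seen as a functional. *)
Definition radon_integral nu (D : set mplane) f : R[i] :=
  cintegral (radon_base nu) D (fun x => f x * radon_density nu x).

Definition test_function g :=
  continuous (g : plane -> R[i]^o) /\ compact (closure [set x | g x != 0]).

(* A finite measure is identified with the functional f |-> \int f. *)
Definition functional := (plane -> R[i]) -> R[i].

Definition reflect_conj (F : functional) : functional :=
  fun g => (F (fun x => (g (- x))^* ))^*.

Definition convolution (F G : functional) : functional :=
  fun g => F (fun x => G (fun y => g (x + y))).

Definition lebesgue2 : {measure set mplane -> \bar R} :=
  (@lebesgue_measure R \x @lebesgue_measure R)%E.

Definition vol (D : set mplane) : R := fine (lebesgue2 D).

Definition is_autocorrelation (omega gamma : radon) :=
  forall g, test_function g ->
    (fun N : nat =>
       let omegaN := radon_integral omega (square N%:R) in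
       convolution omegaN (reflect_conj omegaN) g / (vol (square N%:R))%:C
         : R[i]^o) @ \oo
    --> (radon_integral gamma setT g : R[i]^o).

Definition partial (b : bool) (f : plane -> R) : plane -> R :=
  fun x => 'D_((if b then (0, 1) else (1, 0)) : plane) f x.

(* All iterated partial derivatives exist and are differentiable, and remain
   bounded after multiplication by any monomial. *)
Definition real_schwartz (f : plane -> R) :=
  forall s : seq bool,
    (forall x, differentiable (foldr partial f s) x) /\
    (forall i j : nat, exists c : R, forall x : plane,
       `|x.1 ^+ i * x.2 ^+ j * foldr partial f s x| <= c).

Definition schwartz f :=
  real_schwartz (@complex.Re R \o f) /\ real_schwartz (@complex.Im R \o f).

Definition fourier phi : plane -> R[i] :=
  fun k => cintegral lebesgue2 setT (fun x =>
    let t := 2 * pi * (k.1 * x.1 + k.2 * x.2) in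
    (cos t -i* sin t) * phi x).

(* Fourier transform in the sense of tempered distributions. *)
Definition is_fourier_transform (mu mu_hat : radon) :=
  forall phi, schwartz phi ->
    [/\ radon_integrable mu (fourier phi), radon_integrable mu_hat phi &
        radon_integral mu_hat setT phi = radon_integral mu setT (fourier phi)].

Definition is_diffraction (omega eta : radon) :=
  exists gamma, is_autocorrelation omega gamma /\ is_fourier_transform gamma eta.

Definition lattice : set mplane :=
  range (fun x : int * int => (x.1%:~R, x.2%:~R) : plane).

Lemma measurable_lattice : measurable lattice.
Proof.
apply: countable_measurable; last first.
  exact: card_le_trans (card_image_le _ _) (countableP _).
move=> [a b]; rewrite (_ : [set _] = [set a] `*` [set b]).
  by apply: measurableX; exact: measurable_set1.
by apply/seteqP; split => [x ->//|[x y] [/= -> ->]].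
Qed.

Lemma square_setX (r : R) : square r = `[- r, r] `*` `[- r, r].
Proof.
apply/seteqP; split => x /=; rewrite !in_itv /= -!ler_norml.
  by case=> -> ->.
by case.
Qed.

Lemma measurable_square (r : R) : measurable (square r).
Proof. by rewrite square_setX; apply: measurableX. Qed.

Lemma finite_lattice_square (r : R) : finite_set (square r `&` lattice).
Proof.
pose N := `|Num.ceil r|%N.
pose I : set int := [set k%:Z - N%:Z | k in `I_(N.*2.+1)].
have finI : finite_set I by apply: finite_image; exact: finite_II.
have inI (m : int) : `|m%:~R : R| <= r -> I m.
  move=> mr.
  have : `|m| <= N%:Z.
    rewrite -(ler_int R) intr_norm (le_trans mr)//.
    rewrite (le_trans (ceil_ge r))// ler_int /N.
    by rewrite abszE ler_norm.
  rewrite ler_norml => /andP[lN uN].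
  exists `|(m + N%:Z)%R|%N; last first.
    by rewrite gez0_abs ?addrK// -lerBlDr sub0r.
  rewrite /= -ltz_nat gez0_abs; last by rewrite -lerBlDr sub0r.
  by rewrite -addn1 PoszD -addnn PoszD ltzD1 lerD2r.
apply: (@sub_finite_set _ _
  ((fun x : int * int => (x.1%:~R, x.2%:~R) : plane) @` (I `*` I))).
  by move=> _ [] /[swap] -[[m n] _ <-] [/= mr nr]; exists (m, n) => //; split;
    apply: inI.
by apply: finite_image; exact: finite_setX.
Qed.

Definition lattice_counting : {measure set mplane -> \bar R} :=
  mrestr (counting : {measure set mplane -> \bar R}) measurable_lattice.

(* The value w_x at each lattice point x; the values elsewhere are irrelevant,
   since lattice_counting does not charge them. *)
Definition comb_density (w : configuration) (x : plane) : R[i] :=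
  (spin R (w (Num.floor x.1, Num.floor x.2)))%:C.

Lemma comb_subproof (w : configuration) (r : R) :
  cintegrable lattice_counting (square r) (comb_density w).
Proof.
apply: cintegrable_realC; first exact: measurable_square.
- rewrite /lattice_counting /= /mrestr /counting asboolT ?ltry//.
  exact: finite_lattice_square.
- pose s (b : bool) : R := spin R b.
  apply: (@measurableT_comp _ _ _ _ _ _ s); first by [].
  apply/(measurable_funS measurableT (@subsetT _ _)).
  apply: (measurable_fun_bool true); rewrite setTI.
  rewrite (_ : _ @^-1` _ = \bigcup_m
    (if w m then `[m.1%:~R, (m.1 + 1)%:~R[ `*` `[m.2%:~R, (m.2 + 1)%:~R[
     else set0)).
    apply: countable_bigcupT_measurable; first exact: countableP.
    by move=> m; case: ifP => // _; apply: measurableX.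
  apply/seteqP; split => [[x y] /= wxy|[x y] [[m n] _ /=]].
    exists (Num.floor x, Num.floor y) => //=.
    by rewrite wxy /= !in_itv /= !floor_itv.
  case: ifP => // wmn; rewrite /= !in_itv /=.
  by move=> -[/floor_def -> /floor_def ->].
- exists 1; split=> // M M1 x _ /=.
  by rewrite /spin normrX normrN1 expr1n ltW.
Qed.

(* The Dirac comb \sum_(x in Z^2) w_x delta_x. *)
Definition dirac_comb (w : configuration) : radon := Radon (comb_subproof w).

Lemma delta0_subproof (r : R) :
  cintegrable (dirac ((0, 0) : mplane) : {measure set mplane -> \bar R}) (square r)
    (fun=> 1).
Proof.
apply: (cintegrable_realC (f := cst 1)); first exact: measurable_square.
- by rewrite /= diracE ltry.
- exact: measurable_cst.
- by exists 1; split=> // M M1 x _ /=; rewrite normr1 ltW.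
Qed.

Definition delta0 : radon := Radon delta0_subproof.

Lemma lebesgue_subproof (r : R) :
  cintegrable lebesgue2 (square r) (fun=> 1).
Proof.
apply: (cintegrable_realC (f := cst 1)); first exact: measurable_square.
- rewrite square_setX /lebesgue2 /= product_measure1E//.
  have Ioo : (@lebesgue_measure R `[(- r)%R, r] < +oo)%E.
    by apply: compact_finite_measure; exact: segment_compact.
  by rewrite lte_mul_pinfty// ge0_fin_numE.
- exact: measurable_cst.
- by exists 1; split=> // M M1 x _ /=; rewrite normr1 ltW.
Qed.

Definition lebesgue_radon : radon := Radon lebesgue_subproof.

End measures_on_the_plane.

(* Main.v *)
Require Import Defs.
From HB Require Import structures.
From mathcomp Require Import finmap.
From mathcomp Require Import all_boot all_order all_algebra all_field complex.
From mathcomp Require Import all_classical all_reals all_analysis.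
From mathcomp Require Import measurable_realfun.
From mathcomp Require Import ring lra zify.

(** Fix a lag p in Z^2 and let S_N be the sum of w_x w_{x-p} over the x such
    that x and x - p lie in the box [-N, N]^2 ([lag_sum]).  Tested against g,
    the autocorrelation at stage N is the finite sum of g(p) S_N(p) / (2N)^2,
    where p runs through the lattice points of the support of g.  Hence it is
    enough to show that almost surely S_N(p) / (2N)^2 tends to 0 for every
    p <> 0; for p = 0 the quotient is (2N + 1)^2 / (2N)^2, which tends to 1
    ([comb_autocorrelation]).

    The decay of S_N comes from orthogonality: for fixed p <> 0, the products
    w_x w_{x-p} are pairwise orthogonal for Haar measure
    ([integral_lag_character]).  The product w_x w_{x-p} w_y w_{y-p} is a
    character of the Ledrappier group, and a nontrivial character has mean
    zero.  The dual of the group is the ring F_2[u, v, 1/u, 1/v] modulo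
    1 + u + v, that is, the ring of Laurent polynomials in u and 1 + u; in it,
    the character corresponds, up to a unit, to the product of 1 + u^p and
    1 + u^(y-x), where u^(a, b) stands for u^a (1 + u)^b.  This ring is a
    domain in which u and 1 + u are multiplicatively independent, so the
    product vanishes only if p = 0 or x = y.  Concretely, a configuration that
    detects the character is obtained by specialising u to an element t of a
    large finite field of characteristic 2 and applying an additive functional
    to t^a (1 + t)^b ([ledrappier_nontrivial_character]).

    By orthogonality, S_N has second moment at most (2N + 1)^2, so the second
    moments of S_N / (2N)^2 are summable in N.  The sum over N of the squares
    is then integrable, hence almost surely finite, hence its terms almost
    surely tend to 0 ([lag_sum_cvg0]); a countable intersection over p
    finishes the autocorrelation.

    That Lebesgue measure is the Fourier transform of delta_0 means that the
    value at 0 of the Fourier transform of a Schwartz function is its integral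
    ([fourier_delta0]); what has to be checked is integrability, by comparison
    with 1 / ((1 + x^2) (1 + y^2)), and the measurability of the Fourier
    transform, by Tonelli's theorem. *)

Set Implicit Arguments.
Unset Strict Implicit.
Unset Printing Implicit Defensive.
Import Order.TTheory GRing.Theory Num.Theory.
Import numFieldNormedType.Exports.
Local Open Scope classical_set_scope.
Local Open Scope ring_scope.

(** * Characters of the Ledrappier group *)

(** A field of characteristic 2 is a vector space over F_2, and some coordinate
    of a nonzero vector is nonzero. *)
Lemma boolean_functional (F : finFieldType) (c : F) :
  (2 \in [pchar F])%N -> c != 0 ->
  exists phi : F -> bool, {morph phi : a b / a + b >-> a (+) b} /\ phi c.
Proof.
move=> F2 c0.
pose V : vectType 'F_2 := pPrimeCharType F2.
pose phi i : V -> 'F_2 := coord (vbasis (@fullv _ V)) i.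
have [i ci] : exists i, phi i c != 0.
  apply/existsP; apply: contraR c0 => /existsPn phi0.
  have cV : (c : V) \in fullv by exact: memvf.
  rewrite -[c]/(c : V) (coord_vbasis cV); apply/eqP/big1 => i _.
  by have /negPn/eqP := phi0 i; rewrite /phi => ->; rewrite scale0r.
exists (fun a => phi i a != 0); split=> // a b.
rewrite (_ : phi i (a + b) = phi i a + phi i b); last by rewrite /phi -linearD.
case: (phi i a) (phi i b) => -[|[|//]] a2 [[|[|//]] b2];
  by rewrite -!val_eqE.
Qed.

Lemma card_large_finField2 (n : nat) :
  exists2 F : finFieldType, (2 \in [pchar F])%N & (n < #|F|)%N.
Proof.
have [F F2 cF] := @PrimePowerField 2 n.+1 isT isT.
by exists F => //; rewrite cF; apply: (leq_trans _ (ltn_expl _ _)) => //; lia.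
Qed.

(** The image of the element (a, b) of Z^2 under the specialisation u |-> t of
    the dual ring F_2[u, 1/u, 1/(1+u)] of the Ledrappier group. *)
Definition monomial (F : fieldType) (t : F) (x : int * int) : F :=
  t ^ x.1 * (1 + t) ^ x.2.

Definition pos_part (k : int) : nat := if k is Posz n then n else 0%N.
Definition neg_part (k : int) : nat := if k is Negz n then n.+1 else 0%N.

(** The relation t ^ x.1 * (1 + t) ^ x.2 = 1, cleared of denominators. *)
Definition relation_poly (F : fieldType) (x : int * int) : {poly F} :=
  'X ^+ pos_part x.1 * (1 + 'X) ^+ pos_part x.2 -
  'X ^+ neg_part x.1 * (1 + 'X) ^+ neg_part x.2.

Lemma exprz_pos_neg (F : fieldType) (t : F) (k : int) : t != 0 ->
  t ^ k * t ^+ neg_part k = t ^+ pos_part k.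
Proof.
case: k => n t0 /=; first by rewrite mulr1.
by rewrite /exprz mulVf// expf_neq0.
Qed.

Lemma root_relation_poly (F : fieldType) (t : F) x :
  t != 0 -> 1 + t != 0 -> monomial t x = 1 -> root (relation_poly F x) t.
Proof.
move=> t0 t1 tx; apply/rootP; rewrite /relation_poly !hornerE.
rewrite -(exprz_pos_neg x.1 t0) -(exprz_pos_neg x.2 t1) mulrACA.
by rewrite -/(monomial t x) tx mul1r subrr.
Qed.

Lemma size_add1X (F : fieldType) : size (1 + 'X : {poly F}) = 2.
Proof. by rewrite addrC size_XaddC. Qed.

(** 'X and 1 + 'X are multiplicatively independent: after cancellation of the
    common power of 'X, evaluation at 0 compares the exponents of 'X, and the
    degree compares those of 1 + 'X. *)
Lemma monomial_poly_inj (F : fieldType) (a b c d : nat) :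
  'X ^+ a * (1 + 'X) ^+ b = 'X ^+ c * (1 + 'X) ^+ d :> {poly F} ->
  a = c /\ b = d.
Proof.
wlog ac : a b c d / (a <= c)%N => [hw|].
  by case/orP: (leq_total a c) => /hw h e; [exact: h|case: (h _ _ (esym e))].
have X0 : 'X ^+ a != 0 :> {poly F} by rewrite expf_neq0// polyX_eq0.
rewrite -(subnKC ac) exprD -mulrA => /(mulfI X0) e.
have eca : (c - a = 0)%N.
  move/(congr1 (horner^~ 0)): e; rewrite !hornerE expr1n expr0n.
  by case: (c - a)%N => // n /eqP; rewrite mul0r oner_eq0.
rewrite eca addn0; split=> //.
move/(congr1 (fun p : {poly F} => size p)): e.
rewrite eca expr0 mul1r -[LHS]prednK ?size_poly_gt0; last first.
  by rewrite expf_neq0// -size_poly_eq0 size_add1X.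
rewrite -[RHS]prednK ?size_poly_gt0; last first.
  by rewrite expf_neq0// -size_poly_eq0 size_add1X.
by rewrite !size_exp size_add1X !mul1n => -[].
Qed.

Lemma relation_poly_neq0 (F : fieldType) x : x != 0 -> relation_poly F x != 0.
Proof.
apply: contra; rewrite subr_eq0 => /eqP/monomial_poly_inj[].
by case: x => -[m|m] [n|n] /= e1 e2; first rewrite e1 e2.
Qed.

Lemma size_relation_poly (F : fieldType) x :
  (size (relation_poly F x) <= (`|x.1| + `|x.2|).+1)%N.
Proof.
have sM (a b : nat) :
    (size ('X ^+ a * (1 + 'X) ^+ b : {poly F})%R <= (a + b).+1)%N.
  rewrite (leq_trans (size_polyMleq _ _))// size_polyXn.
  rewrite addSn/= -addnS leq_add2l.
  by rewrite (leq_trans (size_poly_exp_leq _ _))// size_add1X mul1n.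
rewrite (leq_trans (size_polyD _ _))// size_polyN geq_max.
rewrite !(leq_trans (sM _ _))//; case: x => -[m|m] [n|n] /=; lia.
Qed.

(** The excluded values of t are the roots of a nonzero polynomial whose degree
    is bounded in terms of x and y only, so a large field contains a good t. *)
Lemma generic_point (F : finFieldType) (x y : int * int) :
  (`|x.1| + `|x.2| + `|y.1| + `|y.2| + 4 < #|F|)%N -> x != 0 -> y != 0 ->
  exists t : F, [/\ t != 0, 1 + t != 0, monomial t x != 1 & monomial t y != 1].
Proof.
move=> cF x0 y0.
pose Q : {poly F} := 'X * (1 + 'X) * (relation_poly F x * relation_poly F y).
have Q0 : Q != 0.
  rewrite !mulf_neq0 ?relation_poly_neq0 ?polyX_eq0//.
  by rewrite -size_poly_eq0 size_add1X.
have /allPn[t _ Qt] : ~~ all (root Q) (enum F).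
  apply/negP => /(max_poly_roots Q0)/(_ (enum_uniq _)).
  rewrite -cardE ltnNge => /negP; apply.
  have sx := size_relation_poly F x.
  have sy := size_relation_poly F y.
  have sXX : (size ('X * (1 + 'X) : {poly F})%R <= 3)%N.
    by rewrite (leq_trans (size_polyMleq _ _))// size_polyX size_add1X.
  have := size_polyMleq ('X * (1 + 'X)) (relation_poly F x * relation_poly F y).
  rewrite -/Q => /leq_trans; apply.
  have sxy := size_polyMleq (relation_poly F x) (relation_poly F y).
  move: sx sy sXX sxy cF.
  move: #|_| (size _) (size _) (size _) (size _).
  move: `|x.1|%N `|x.2|%N `|y.1|%N `|y.2|%N.
  lia.
move: Qt; rewrite /Q !rootM !negb_or.
move=> /andP[/andP[tX tX1] /andP[tx ty]].
have t0 : t != 0 by move: tX; rewrite rootX.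
have t1 : 1 + t != 0 by move: tX1; rewrite /root !hornerE.
exists t; split=> //.
  by apply: contra tx => /eqP; exact: root_relation_poly.
by apply: contra ty => /eqP; exact: root_relation_poly.
Qed.

Definition field_configuration (F : fieldType) (t : F) (phi : F -> bool) :
  configuration := fun x => phi (monomial t x).

Lemma monomialD (F : fieldType) (t : F) x y : t != 0 -> 1 + t != 0 ->
  monomial t (x + y) = monomial t x * monomial t y.
Proof. by move=> t0 t1; rewrite /monomial /= !expfzDr// mulrACA. Qed.

Lemma monomial_neq0 (F : fieldType) (t : F) x : t != 0 -> 1 + t != 0 ->
  monomial t x != 0.
Proof. by move=> t0 t1; rewrite mulf_neq0// expfz_neq0. Qed.

(** The relation at x asks that phi (t^x * (1 + t + (1 + t))) be false, and the
    argument of phi is 0 in characteristic 2. *)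
Lemma field_configuration_ledrappier (F : finFieldType) (t : F)
    (phi : F -> bool) :
  (2 \in [pchar F])%N -> t != 0 -> 1 + t != 0 ->
  {morph phi : a b / a + b >-> a (+) b} ->
  ledrappier_set (field_configuration t phi).
Proof.
move=> F2 t0 t1 phiD x; rewrite /field_configuration /= !monomialD//.
rewrite /spin -!signr_addb -!phiD.
rewrite (_ : _ + _ = 0).
  by have := phiD 0 0; rewrite addr0 addbb => ->.
rewrite -[X in X + _ + _]mulr1 -!mulrDr /monomial /= !expr1z !expr0z mulr1 mul1r.
by rewrite addrr_pchar2// mulr0.
Qed.

(** In F_2[u, 1/u, 1/(1+u)], this sum of four coordinates corresponds to the
    product of u^x, 1 + u^p and 1 + u^q.  The element [c] below is its
    specialisation at t, and phi is chosen so that it does not vanish at c. *)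
Lemma ledrappier_nontrivial_character (x p q : int * int) :
  p != 0 -> q != 0 ->
  exists v : ledrappier, set_val v x (+) set_val v (x + p) (+)
    (set_val v (x + q) (+) set_val v (x + q + p)).
Proof.
move=> p0 q0.
have [F F2 cF] := card_large_finField2 (`|p.1| + `|p.2| + `|q.1| + `|q.2| + 4).
have [t [t0 t1 tp tq]] := generic_point cF p0 q0.
pose c := monomial t x * (1 + monomial t p) * (1 + monomial t q).
have m1 z : monomial t z != 1 -> 1 + monomial t z != 0.
  by apply: contra; rewrite addr_eq0 oppr_pchar2// eq_sym.
have c0 : c != 0.
  by rewrite (mulf_neq0 (mulf_neq0 (monomial_neq0 _ t0 t1) (m1 _ tp)) (m1 _ tq)).
have [phi [phiD phic]] := boolean_functional F2 c0.
have vL := field_configuration_ledrappier F2 t0 t1 phiD.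
have vE z : set_val (SigSub (mem_set vL) : ledrappier) z = phi (monomial t z).
  by [].
exists (SigSub (mem_set vL)); rewrite !vE !monomialD// -!phiD.
by rewrite (_ : _ + _ = c)// /c; ring.
Qed.

(** * Almost sure convergence from summable means *)

Lemma nneseries_lty_cvg0 (R : realType) (u : R^nat) :
  (forall n, 0 <= u n) -> (\sum_(n <oo) (u n)%:E < +oo)%E -> u @ \oo --> 0.
Proof.
move=> u0 uoo; apply: cvg_series_cvg_0.
apply: nondecreasing_is_cvgn.
  exact: (@nondecreasing_series _ u xpredT).
have S0 : (0 <= \sum_(n <oo) (u n)%:E)%E.
  by apply: nneseries_ge0 => n _ _; rewrite lee_fin.
exists (fine (\sum_(n <oo) (u n)%:E)%E) => _ [n _ <-].
rewrite -lee_fin fineK ?ge0_fin_numE// /series /= -sumEFin.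
by apply: nneseries_lim_ge => k _ _; rewrite lee_fin.
Qed.

(** The sum of the X n has finite integral by monotone convergence, hence is
    finite almost everywhere. *)
Lemma ae_cvg0_summable d (T : measurableType d) (R : realType)
    (mu : {measure set T -> \bar R}) (X : (T -> R)^nat) :
  (forall n, measurable_fun setT (X n)) -> (forall n t, 0 <= X n t) ->
  (\sum_(n <oo) \int[mu]_t (X n t)%:E < +oo)%E ->
  {ae mu, forall t, X ^~ t @ \oo --> 0}.
Proof.
move=> mX X0 sumX.
have mEX n : measurable_fun setT (EFin \o X n) by exact/measurable_EFinP.
have EX0 n t : setT t -> (0 <= (X n t)%:E)%E by rewrite lee_fin.
have F0 t : (0 <= \sum_(n <oo) (X n t)%:E)%E.
  by apply: nneseries_ge0 => n _ _; exact: EX0.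
have intF : mu.-integrable setT (fun t => \sum_(n <oo) (X n t)%:E)%E.
  apply/integrableP; split.
    have := @ge0_emeasurable_sum _ T R setT (fun n => EFin \o X n) xpredT.
    by apply => // n t _ _; exact: EX0.
  under eq_integral do rewrite gee0_abs//.
  by rewrite integral_nneseries.
apply: filterS (integrable_ae measurableT intF) => t /(_ I) Ft.
by apply: nneseries_lty_cvg0 => //; rewrite -ge0_fin_numE.
Qed.

(** * Boxes in the lattice *)

Definition int_range (N : nat) : seq int :=
  [seq k%:Z - N%:Z | k <- iota 0 (N.*2 + 1)].

Lemma mem_int_range N (k : int) : (k \in int_range N) = (`|k| <= N%:Z).
Proof.
apply/mapP/idP => [[i + ->]|kN]; first by rewrite mem_iota; lia.
by exists `|(k + N%:Z)%R|%N; rewrite ?mem_iota; lia.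
Qed.

Definition box (N : nat) : seq (int * int) :=
  [seq (a, b) | a <- int_range N, b <- int_range N].

Lemma mem_box N x : (x \in box N) = (`|x.1| <= N%:Z) && (`|x.2| <= N%:Z).
Proof.
apply/allpairsP/andP => [[[a b] [/= aN bN ->]]|[x1 x2]].
  by rewrite -!mem_int_range.
by exists x; rewrite -surjective_pairing !mem_int_range.
Qed.

Lemma uniq_int_range N : uniq (int_range N).
Proof. by rewrite map_inj_uniq ?iota_uniq// => a b /addIr[]. Qed.

Lemma uniq_box N : uniq (box N).
Proof. by apply: allpairs_uniq; rewrite ?uniq_int_range// => -[a b] [c d]. Qed.

Lemma size_box N : size (box N) = ((N.*2 + 1) ^ 2)%N.
Proof. by rewrite size_allpairs !size_map size_iota mulnn. Qed.

(** * Orthogonality with respect to Haar measure *)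

Section haar.
Variables (R : realType) (mu : probability (borel ledrappier) R).

Lemma measurable_coordinate (x : int * int) :
  measurable_fun setT (fun w : borel ledrappier => set_val (w : ledrappier) x).
Proof.
apply: (measurable_fun_bool true); rewrite setTI.
apply: sub_sigma_algebra.
pose f := fun w : ledrappier => set_val w x.
have cf : continuous f.
  move=> w; apply: (@continuous_comp _ _ _ (set_val : ledrappier -> configuration)
     (fun c : configuration => c x)).
    exact: initial_continuous.
  exact: (@proj_continuous _ (fun=> bool) x).
apply: (open_comp (f := f : ledrappier -> bool) (D := [set true])).
  by move=> w _; exact: cf.
exact: discrete_open.
Qed.

Lemma measurable_spin d (T : measurableType d) (b : T -> bool) :
  measurable_fun setT b -> measurable_fun setT (fun w => spin R (b w)).
Proof. by move=> mb; exact: (measurableT_comp (f := spin R)). Qed.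

Lemma integrable_spin (b : borel ledrappier -> bool) :
  measurable_fun setT b -> mu.-integrable setT (fun w => (spin R (b w))%:E).
Proof.
move=> mb; apply: (measurable_bounded_integrable (f := fun w => spin R (b w))) => //.
- by rewrite -ge0_fin_numE// fin_num_measure.
- exact: measurable_spin.
- exists 1; split=> // M M1 w _ /=.
  by rewrite /spin normrX normrN1 expr1n ltW.
Qed.

Hypothesis mu_haar : is_haar mu.

(** Translation by v, where b v is true, exchanges the fibres of b over true and
    false, which therefore have the same measure. *)
Lemma haar_integral_character (b : borel ledrappier -> bool) :
  measurable_fun setT b ->
  (forall v w : ledrappier, b (ledrappier_mul v w) = b v (+) b w) ->
  (exists v, b v) ->
  (\int[mu]_w (spin R (b w))%:E = 0)%E.
Proof.
move=> mb bM [v bv].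
pose A c := [set w | b w = c].
have mA c : measurable (A c).
  by rewrite -[A c]setTI; apply: (mb measurableT [set c]).
have mul2 (w : ledrappier) : ledrappier_mul v (ledrappier_mul v w) = w.
  apply/val_inj/funext => x /=.
  by rewrite addbA addbb.
have AE : ledrappier_mul v @` A false = A true.
  apply/seteqP; split=> [_ [w bw <-]|w bw].
    by rewrite /A /= bM bv [b w]bw.
  by exists (ledrappier_mul v w) => /=; rewrite ?mul2// /A /= bM bv [b w]bw.
have muA : mu (A true) = mu (A false) by rewrite -AE mu_haar.
have E w : (spin R (b w))%:E = ((\1_(A false) w)%:E - (\1_(A true) w)%:E)%E.
  rewrite -EFinB !indicE /spin /A; congr (_%:E).
  case: (boolP (b w)) => bw.
    by rewrite memNset /= ?bw// mem_set /= ?bw// sub0r.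
  by rewrite mem_set /= ?(negbTE bw)// memNset /= ?(negbTE bw)// subr0.
under eq_integral do rewrite E.
have intA c : mu.-integrable setT (EFin \o \1_(A c)).
  by apply: integrable_indic => //; rewrite -ge0_fin_numE// fin_num_measure.
have muI c : (\int[mu]_x (\1_(A c) x)%:E = mu (A c))%E.
  by rewrite integral_indic// setIT.
rewrite integralB//; [|exact: (intA false)|exact: (intA true)].
rewrite [X in (X - _)%E]muI [X in (_ - X)%E]muI muA subee//.
exact: fin_num_measure.
Qed.

(** The exponent of the product w_x w_{x-p} w_y w_{y-p}. *)
Definition lag_character (p x y : int * int) (w : ledrappier) : bool :=
  set_val w x (+) set_val w (x - p) (+) (set_val w y (+) set_val w (y - p)).

Lemma measurable_addb d (T : measurableType d) (f g : T -> bool) :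
  measurable_fun setT f -> measurable_fun setT g ->
  measurable_fun setT (fun t => f t (+) g t).
Proof.
move=> mf mg.
rewrite (_ : (fun t => _) = (fun t => if f t then ~~ g t else g t)).
  by apply: measurable_fun_ifT => //; exact: measurable_neg.
by apply/funext => t; case: (f t).
Qed.

Lemma measurable_lag_character p x y :
  measurable_fun setT (lag_character p x y : borel ledrappier -> bool).
Proof. by do 2!apply: measurable_addb; exact: measurable_coordinate. Qed.

Lemma integral_lag_character (p x y : int * int) : p != 0 ->
  (\int[mu]_w (spin R (lag_character p x y w))%:E = (x == y)%:R%:E)%E.
Proof.
move=> p0; case: eqVneq => [->|xy].
  rewrite (eq_integral (cst 1%E)).
    by rewrite integral_cst// mul1e -[RHS](probability_setT mu).
  by move=> w _; rewrite /lag_character addbb.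
apply: haar_integral_character.
- exact: measurable_lag_character.
- move=> v w; rewrite /lag_character /=.
  rewrite [X in X (+) _ = _]addbACA [X in _ (+) X = _]addbACA.
  exact: addbACA.
- have [||v vxy] := @ledrappier_nontrivial_character x (- p) (y - x).
  + by rewrite oppr_eq0.
  + by rewrite subr_eq0 eq_sym.
  by exists v; move: vxy; rewrite [x + (y - x)]addrC subrK.
Qed.

Definition lag_sum (p : int * int) (N : nat) (w : configuration) : R :=
  \sum_(x <- box N | x - p \in box N) spin R (w x) * spin R (w (x - p)).

Lemma measurable_lag_sum p N :
  measurable_fun setT
    (fun w : borel ledrappier => lag_sum p N (set_val (w : ledrappier))).
Proof.
rewrite (_ : (fun w => _) = (fun w : borel ledrappier =>
  \sum_(x <- [seq x <- box N | x - p \in box N])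
    spin R (set_val (w : ledrappier) x) *
    spin R (set_val (w : ledrappier) (x - p)))).
  apply: measurable_sum => x; apply: measurable_funM;
    by apply: measurable_spin; exact: measurable_coordinate.
by apply/funext => w; rewrite big_filter.
Qed.

Lemma lag_sum_sqr p N (w : ledrappier) : lag_sum p N (set_val w) ^+ 2 =
  \sum_(x <- box N | (x - p)%R \in box N) \sum_(y <- box N | (y - p)%R \in box N)
    spin R (lag_character p x y w).
Proof.
rewrite expr2 /lag_sum mulr_suml; apply: eq_bigr => x _.
rewrite mulr_sumr; apply: eq_bigr => y _.
by rewrite /spin !signr_addb.
Qed.

(** By orthogonality, only the diagonal terms x = y of the double sum survive. *)
Lemma integral_lag_sum_sqr (p : int * int) N : p != 0 ->
  (\int[mu]_w (lag_sum p N (set_val (w : ledrappier)) ^+ 2)%:E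
     <= (((N.*2 + 1) ^ 2)%N)%:R%:E)%E.
Proof.
move=> p0.
have intc x y := integrable_spin (measurable_lag_character p x y).
rewrite (eq_integral (fun w : borel ledrappier =>
  \sum_(x <- box N | (x - p)%R \in box N) \sum_(y <- box N | (y - p)%R \in box N)
    (spin R (lag_character p x y w))%:E)%E); last first.
  move=> w _; rewrite lag_sum_sqr -sumEFin.
  by apply: eq_bigr => x _; rewrite -sumEFin.
rewrite integral_sum//; last first.
  by move=> x; apply: integrable_sum => // y _; exact: intc.
under eq_bigr => x _.
  rewrite integral_sum//.
  under eq_bigr do rewrite integral_lag_character//.
  rewrite sumEFin.
  over.
rewrite sumEFin lee_fin -size_box -[in leRHS]sum1_size natr_sum.
rewrite big_mkcond/=; apply: ler_sum => x _; case: ifP => // _.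
rewrite -natr_sum ler_nat; apply: (@leq_trans (\sum_(y <- box N | y == x) 1)).
  rewrite big_mkcond [leqRHS]big_mkcond; apply: leq_sum => y _.
  by rewrite eq_sym; case: ifP => //; case: eqP.
by rewrite sum1_count count_uniq_mem ?uniq_box// leq_b1.
Qed.

(** The second moment at N is at most (2N + 1)^2 / (2N)^4, which for N > 0 is
    dominated by the telescoping term 2 / N - 2 / (N + 1). *)
Lemma lag_sum_cvg0 (p : int * int) : p != 0 ->
  {ae mu, forall w : borel ledrappier,
    lag_sum p N (set_val (w : ledrappier)) / (2 * N%:R) ^+ 2
      @[N --> \oo] --> 0}.
Proof.
move=> p0.
pose X (N : nat) (w : borel ledrappier) : R :=
  (lag_sum p N (set_val (w : ledrappier)) / (2 * N%:R) ^+ 2) ^+ 2.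
have mX N : measurable_fun setT (X N).
  apply: measurable_funX; apply: measurable_funM => //.
  exact: measurable_lag_sum.
have bound (N : nat) : (\int[mu]_w (X N w)%:E <=
   (if N is n.+1 then 2 / n.+1%:R - 2 / n.+2%:R else 0)%:E)%E.
  under eq_integral do rewrite /X expr_div_n EFinM.
  rewrite ge0_integralZr//; [| |by move=> w _; rewrite lee_fin sqr_ge0];
    last first.
    by apply/measurable_EFinP; apply: measurable_funX; exact: measurable_lag_sum.
  case: N => [|n]; first by rewrite mulr0 expr0n/= expr0n/= invr0 mule0.
  apply: (@le_trans _ _ ((((n.+1.*2 + 1) ^ 2)%N)%:R%:E *
      (((2 * n.+1%:R) ^+ 2) ^+ 2)^-1%:E)%E).
    apply: lee_wpmul2r; last exact: integral_lag_sum_sqr.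
    by rewrite lee_fin invr_ge0 sqr_ge0.
  rewrite -EFinM lee_fin ler_pdivrMr ?exprn_gt0 ?mulr_gt0//.
  rewrite natrX natrD -mul2n natrM -[n.+2]addn1 natrD.
  have : 1 <= n.+1%:R :> R by rewrite ler1n.
  move: (n.+1%:R) => m m1.
  have m0 : 0 < m by lra.
  rewrite (_ : 2 / m - 2 / (m + 1) = 2 / (m * (m + 1))); last first.
    by field; rewrite ?gt_eqF//; lra.
  rewrite mulrAC ler_pdivlMr; last by rewrite mulr_gt0//; lra.
  have : 0 <= (m - 1) * m ^+ 3 by apply: mulr_ge0; [|apply: exprn_ge0]; lra.
  have : 0 <= (m - 1) * m ^+ 2 by apply: mulr_ge0; [|apply: exprn_ge0]; lra.
  have : 0 <= (m - 1) * m ^+ 1 by apply: mulr_ge0; [|apply: exprn_ge0]; lra.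
  nra.
have sumX : (\sum_(N <oo) \int[mu]_w (X N w)%:E < +oo)%E.
  apply: (@le_lt_trans _ _ 2%:E); last by rewrite ltry.
  apply: lime_le.
    by apply: is_cvg_nneseries => N _ _; apply: integral_ge0 => w _;
      rewrite lee_fin sqr_ge0.
  apply: nearW => -[|N]; first by rewrite big_geq.
  (* The telescoped bound on the sum of the first N + 1 terms. *)
  apply: (@le_trans _ _ (2 - 2 / N.+1%:R)%:E); last first.
    by rewrite lee_fin gerBl divr_ge0.
  elim: N => [|N ih].
    rewrite big_nat1 (le_trans (bound 0%N))// lee_fin; lra.
  rewrite big_nat_recr//= (le_trans (leeD ih (bound _)))// -EFinD lee_fin.
  by rewrite addrA subrK.
have X0 N w : 0 <= X N w by rewrite sqr_ge0.
apply: filterS (ae_cvg0_summable mX X0 sumX) => w Xw.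
apply/norm_cvg0P.
rewrite (_ : (fun N => _) = (fun N => Num.sqrt (X N w))); last first.
  by apply/funext => N; rewrite /X sqrtr_sqr.
rewrite -(sqrtr0 R); apply: (continuous_cvg _ _ Xw).
exact: sqrt_continuous.
Qed.

Lemma ae_lag_sum_cvg0 :
  {ae mu, forall w : borel ledrappier, forall p : int * int, p != 0 ->
    lag_sum p N (set_val (w : ledrappier)) / (2 * N%:R) ^+ 2
      @[N --> \oo] --> 0}.
Proof.
(* The lags are enumerated by pickling, with void conditions at the integers
   that do not encode a lag. *)
pose P (n : nat) (w : borel ledrappier) :=
  forall p : int * int, unpickle n = Some p -> p != 0 ->
  lag_sum p N (set_val (w : ledrappier)) / (2 * N%:R) ^+ 2 @[N --> \oo] --> 0.
have : forall n, {ae mu, forall w : borel ledrappier, P n w}.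
  move=> n; rewrite /P; case: unpickle => [p|]; last by apply: aeW.
  have [->|p0] := eqVneq p 0.
    by apply: aeW => w _ [<-]; rewrite eqxx.
  by have := lag_sum_cvg0 p0; apply: filterS => w Pw _ [<-].
move/ae_foralln; apply: filterS => w Pw p; apply: (Pw (pickle p)).
by rewrite pickleK.
Qed.

End haar.

(** * Complex-valued measurable functions on the plane *)

Local Open Scope complex_scope.

Section measurability.
Variable R : realType.
Local Notation plane := (R * R)%type.
Local Notation mplane := (measurableTypeR R * measurableTypeR R)%type.

(** An open set is the union of the countably many rational rectangles that it
    contains. *)
Lemma open_plane_measurable (A : set plane) :
  open A -> measurable (A : set mplane).
Proof.
move=> oA.
pose Q (q : (rat * rat) * (rat * rat)) : set mplane :=
  `]ratr q.1.1, ratr q.1.2[ `*` `]ratr q.2.1, ratr q.2.2[.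
rewrite (_ : (A : set mplane) =
    \bigcup_q (if `[< Q q `<=` A >] then Q q else set0)).
  apply: countable_bigcupT_measurable; first exact: countableP.
  by move=> q; case: ifP => // _; apply: measurableX.
apply/seteqP; split=> [[x y] Axy|z [q _]]; last by case: asboolP => // qA /qA.
have /nbhs_ballP[e /= e0 eA] : nbhs (x, y) A by exact: open_nbhs_nbhs.
have close (t : R) : exists q : rat * rat,
    ratr q.1 < t /\ t < ratr q.2 /\
    (forall s, ratr q.1 < s -> s < ratr q.2 -> `|t - s| < e).
  have [q1 q1t] : exists q, ratr q \in `]t - e / 2, t[.
    by apply: rat_in_itvoo; rewrite ltrBlDr ltrDl divr_gt0.
  have [q2 q2t] : exists q, ratr q \in `]t, t + e / 2[.
    by apply: rat_in_itvoo; rewrite ltrDl divr_gt0.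
  move: q1t q2t; rewrite !in_itv /= => /andP[q1l q1r] /andP[q2l q2r].
  exists (q1, q2); split=> //; split=> // s s1 s2; rewrite ltr_norml.
  by apply/andP; split; move: q1l q1r q2l q2r s1 s2 => /=; lra.
have [q [xl [xr xe]]] := close x; have [r [yl [yr ye]]] := close y.
exists (q, r) => //; case: asboolP => [_|[]].
  by split; rewrite /= in_itv /= ?xl ?yl.
move=> -[s t] [/=]; rewrite !in_itv /= => /andP[sl sr] /andP[tl tr].
apply: eA; split; rewrite /ball /=; [exact: xe|exact: ye].
Qed.

Lemma continuous_plane_measurable (f : plane -> R) : continuous f ->
  measurable_fun setT (f : mplane -> R).
Proof.
move=> cf; apply: (measurability _ (RGenOpens.measurableE R)).
move=> _ [_ [a [b ->] <-]]; rewrite setTI.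
apply: open_plane_measurable; apply: open_comp; last exact: interval_open.
by move=> ? _; exact: cf.
Qed.

Definition cmeasurable d (T : measurableType d) (D : set T) (h : T -> R[i]) :=
  measurable_fun D (@complex.Re R \o h) /\ measurable_fun D (@complex.Im R \o h).

Lemma cmeasurableM d (T : measurableType d) (D : set T) (h k : T -> R[i]) :
  cmeasurable D h -> cmeasurable D k -> cmeasurable D (fun x => h x * k x).
Proof.
move=> [h1 h2] [k1 k2]; split.
  rewrite (_ : _ \o _ = (@complex.Re R \o h) \* (@complex.Re R \o k) \-
                        (@complex.Im R \o h) \* (@complex.Im R \o k)).
    by apply: measurable_funB; exact: measurable_funM.
  by apply/funext => x /=; case: (h x) (k x) => [a b] [c d'].
rewrite (_ : _ \o _ = (@complex.Re R \o h) \* (@complex.Im R \o k) \+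
                        (@complex.Im R \o h) \* (@complex.Re R \o k)).
  by apply: measurable_funD; exact: measurable_funM.
by apply/funext => x /=; case: (h x) (k x) => [a b] [c d'].
Qed.

Lemma cmeasurableJ d (T : measurableType d) (D : set T) (h : T -> R[i]) :
  cmeasurable D h -> cmeasurable D (fun x => (h x)^*).
Proof.
move=> [h1 h2]; split.
  rewrite (_ : _ \o _ = (@complex.Re R \o h))//.
  by apply/funext => x /=; case: (h x).
rewrite (_ : _ \o _ = \- (@complex.Im R \o h)).
  by apply: measurableT_comp.
by apply/funext => x /=; case: (h x).
Qed.

Lemma cmeasurable_cst d (T : measurableType d) (D : set T) (c : R[i]) :
  cmeasurable D (fun=> c).
Proof. by split; exact: measurable_cst. Qed.

Lemma cmeasurable_sum d (T : measurableType d) (D : set T) I (s : seq I)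
    (h : I -> T -> R[i]) :
  (forall i, cmeasurable D (h i)) ->
  cmeasurable D (fun x => \sum_(i <- s) h i x).
Proof.
move=> mh; split.
  rewrite (_ : _ \o _ = fun x => \sum_(i <- s) (@complex.Re R \o h i) x).
    by apply: measurable_sum => i; case: (mh i).
  by apply/funext => x /=; rewrite raddf_sum.
rewrite (_ : _ \o _ = fun x => \sum_(i <- s) (@complex.Im R \o h i) x).
  by apply: measurable_sum => i; case: (mh i).
by apply/funext => x /=; rewrite raddf_sum.
Qed.

Lemma normc_ge_Im (x : R[i]) : `|complex.Im x|%:C <= `|x|.
Proof.
by case: x => a b; simpc; rewrite -sqrtr_sqr ler_wsqrtr // lerDr sqr_ge0.
Qed.

Lemma continuous_Re : continuous (@complex.Re R : R[i]^o -> R).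
Proof.
move=> z; apply/(cvgrPdist_lt (FF := nbhs_filter (z : R[i]^o))) => e e0.
exists e%:C => [|t /= zt]; first by rewrite /= ltcR.
rewrite -raddfB -ltcR.
exact: le_lt_trans (normc_ge_Re _) zt.
Qed.

Lemma continuous_Im : continuous (@complex.Im R : R[i]^o -> R).
Proof.
move=> z; apply/(cvgrPdist_lt (FF := nbhs_filter (z : R[i]^o))) => e e0.
exists e%:C => [|t /= zt]; first by rewrite /= ltcR.
rewrite -raddfB -ltcR.
exact: le_lt_trans (normc_ge_Im _) zt.
Qed.

Lemma continuous_cmeasurable (g : plane -> R[i]) (D : set mplane) :
  continuous (g : plane -> R[i]^o) -> cmeasurable D (g : mplane -> R[i]).
Proof.
move=> cg; split; apply: measurable_funTS; apply: continuous_plane_measurable => x;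
  apply: (@continuous_comp _ _ _ (g : plane -> R[i]^o)); try exact: cg.
  exact: continuous_Re.
exact: continuous_Im.
Qed.

Lemma cvg_real_complex (u : R^nat) (l : R) :
  u @ \oo --> l -> (fun n => (u n)%:C : R[i]^o) @ \oo --> (l%:C : R[i]^o).
Proof.
move=> ul; apply/cvgrPdist_lt => -[e e'] /[dup].
rewrite {1}ltcE /= => /andP[/eqP -> e0] _.
have : \forall n \near \oo, `|l - u n| < e by apply: cvgr_dist_lt.
apply: filterS => n une; rewrite -raddfB /= normc_def /= expr0n /= addr0 sqrtr_sqr.
by rewrite ltcR.
Qed.

End measurability.

(** * Integration against the lattice *)

Lemma counting_seq (T : choiceType) (R : realType) (s : seq T) :
  uniq s -> counting [set` s] = (size s)%:R%:E :> \bar R.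
Proof.
move=> us; rewrite /counting asboolT; last exact: finite_seq.
rewrite (_ : [set` s] = [set` [fset x in s]%fset]).
  by rewrite set_fsetK card_fseq undup_id.
by apply/seteqP; split=> x /=; rewrite inE.
Qed.

(** The integral over D depends only on the values of m on the subsets of D, so
    m can be replaced by the sum of Dirac masses; real functions reduce to
    nonnegative ones through their positive and negative parts. *)
Lemma integral_sum_dirac d (T : measurableType d) (R : realType)
    (m : {measure set T -> \bar R}) (D : set T) (s : seq T) (f : T -> R) :
  measurable D -> (forall z, z \in s -> D z) ->
  (forall A, measurable A -> A `<=` D -> m A = (\sum_(z <- s) \d_z A)%E) ->
  measurable_fun D f ->
  (\int[m]_(x in D) (f x)%:E = (\sum_(z <- s) f z)%:E)%E.
Proof.
move=> mD sD mE mf.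
have [s0|[z0 _]] : s = [::] \/ exists z0, z0 \in s.
  by case: s {sD mE} => [|z s]; [left|right; exists z; rewrite mem_head].
  rewrite s0 big_nil (eq_measure_integral mzero) ?integral_measure_zero//.
  by move=> A mA AD; rewrite mE// s0 big_nil.
pose m_ k : {measure set T -> \bar R} := \d_(nth z0 s k).
have E (f' : T -> \bar R) : measurable_fun D f' -> (forall x, D x -> 0 <= f' x)%E ->
    (\int[m]_(x in D) f' x = \sum_(z <- s) f' z)%E.
  move=> mf' f'0; rewrite (eq_measure_integral (msum m_ (size s))); last first.
    by move=> A mA AD; rewrite mE// (big_nth z0) big_mkord.
  rewrite ge0_integral_measure_sum// (big_nth z0) big_mkord.
  apply: eq_bigr => k _; rewrite integral_dirac// diracE mem_set ?mul1e//.
  by apply/sD/mem_nth.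
have mEf : measurable_fun D (EFin \o f) by exact/measurable_EFinP.
rewrite integralE !E//; try exact: measurable_funepos; try exact: measurable_funeneg.
rewrite funerpos funerneg /= !sumEFin -EFinB -sumrB; congr (_%:E).
apply: eq_bigr => z _; rewrite /funrpos /funrneg.
by have [fz|fz] := leP (f z) 0; have [nfz|nfz] := leP (- f z) 0; lra.
Qed.

Section comb.
Variable R : realType.
Local Notation plane := (R * R)%type.
Local Notation mplane := (measurableTypeR R * measurableTypeR R)%type.

Definition lattice_point (z : int * int) : mplane := (z.1%:~R, z.2%:~R).

Lemma lattice_point_inj : injective lattice_point.
Proof. by move=> [a b] [c d] [/intr_inj -> /intr_inj ->]. Qed.

Lemma lattice_point_square N z :
  z \in box N -> square N%:R (lattice_point z).
Proof.
rewrite mem_box => /andP[z1 z2]; rewrite /square /= -!intr_norm.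
by rewrite -![N%:R]/(N%:Z%:~R) !ler_int.
Qed.

Lemma square_latticeP N (x : mplane) : square N%:R x -> lattice x ->
  exists2 z, z \in box N & x = lattice_point z.
Proof.
move=> [x1 x2] [z _ zx]; exists z => //; rewrite mem_box.
move: x1 x2; rewrite -zx /= -!intr_norm.
by rewrite -![N%:R]/(N%:Z%:~R) !ler_int => -> ->.
Qed.

Lemma lattice_counting_box N (A : set mplane) : A `<=` square N%:R ->
  lattice_counting R A = (\sum_(z <- map lattice_point (box N)) \d_z A)%E.
Proof.
move=> AN; rewrite /lattice_counting /= /mrestr.
have -> : A `&` lattice (R := R) =
    [set` [seq z <- map lattice_point (box N) | z \in A]].
  apply/seteqP; split=> x /=.
    move=> [Ax lx]; have [z zN xz] := square_latticeP (AN _ Ax) lx.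
    by rewrite mem_filter mem_set//= xz map_f.
  rewrite mem_filter => /andP[/set_mem Ax /mapP[z zN xz]]; split=> //.
  by exists z.
rewrite counting_seq ?filter_uniq ?map_inj_uniq ?uniq_box//; last first.
  exact: lattice_point_inj.
under [RHS]eq_bigr do rewrite diracE.
rewrite sumEFin size_filter -sum1_count natr_sum big_mkcond; congr (_%:E).
by apply: eq_bigr => z _; case: (_ \in A).
Qed.

End comb.

Section autocorrelation.
Variable R : realType.
Local Notation plane := (R * R)%type.
Local Notation mplane := (measurableTypeR R * measurableTypeR R)%type.
Local Notation pt := (@lattice_point R).

Lemma complex_of_sums I (s : seq I) (h : I -> R[i]) :
  (\sum_(i <- s) complex.Re (h i)) +i* (\sum_(i <- s) complex.Im (h i)) =
  \sum_(i <- s) h i.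
Proof. by rewrite -!raddf_sum; case: (\sum_(i <- s) h i). Qed.

Lemma cintegral_lattice_counting N (h : mplane -> R[i]) :
  cmeasurable (square N%:R) h ->
  cintegral (lattice_counting R) (square N%:R) h =
  \sum_(z <- box N) h (pt z).
Proof.
move=> [mRe mIm]; rewrite /cintegral /Rintegral.
have E f : measurable_fun (square N%:R) f ->
    fine (\int[lattice_counting R]_(x in square N%:R) (f x)%:E)%E =
    \sum_(z <- box N) f (pt z).
  move=> mf; rewrite (@integral_sum_dirac _ _ _ _ _ (map pt (box N))) ?big_map//.
  - exact: measurable_square.
  - by move=> _ /mapP[z zN ->]; exact: lattice_point_square.
  - by move=> A _; exact: lattice_counting_box.
by rewrite !E// complex_of_sums.
Qed.

Lemma comb_density_lattice_point (w : configuration) z :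
  comb_density (R := R) w (pt z) = (spin R (w z))%:C.
Proof. by rewrite /comb_density /= !intrKfloor -surjective_pairing. Qed.

Lemma cmeasurable_comb_density (w : configuration) (r : R) :
  cmeasurable (square r) (comb_density w : mplane -> R[i]).
Proof.
by have [/measurable_int/measurable_EFinP ? /measurable_int/measurable_EFinP ?] :=
  comb_subproof w r.
Qed.

(** * Autocorrelation of the Dirac comb *)

Lemma radon_integral_comb (w : configuration) N (f : plane -> R[i]) :
  cmeasurable (square N%:R) (f : mplane -> R[i]) ->
  radon_integral (dirac_comb R w) (square N%:R) f =
  \sum_(z <- box N) f (pt z) * (spin R (w z))%:C.
Proof.
move=> mf; rewrite /radon_integral cintegral_lattice_counting.
  by apply: eq_bigr => z _ /=; rewrite comb_density_lattice_point.
by apply: cmeasurableM => //; exact: cmeasurable_comb_density.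
Qed.

(** The two conjugations in the reflected functional cancel because the weights
    of the comb are real. *)
Lemma convolution_comb (w : configuration) N (g : plane -> R[i]) :
  continuous (g : plane -> R[i]^o) ->
  let omegaN := radon_integral (dirac_comb R w) (square N%:R) in
  convolution omegaN (reflect_conj omegaN) g =
  \sum_(x <- box N) \sum_(z <- box N)
    g (pt (x - z)) * (spin R (w x) * spin R (w z))%:C.
Proof.
move=> cg /=; rewrite /convolution /reflect_conj.
have inner (x : plane) :
    (radon_integral (dirac_comb R w) (square N%:R)
       (fun y : plane => (g (x + - y))^*))^* =
    \sum_(z <- box N) g (x - pt z : plane) * (spin R (w z))%:C.
  rewrite radon_integral_comb.
    rewrite raddf_sum; apply: eq_bigr => z _.
    by rewrite /= rmorphM/= conjcK; congr (_ * _); rewrite /conjc /= oppr0.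
  apply: cmeasurableJ.
  apply: (@continuous_cmeasurable _ (fun y => g (x - y))) => y.
  apply: (@continuous_comp _ _ _ (fun y : plane => x - y) (g : plane -> R[i]^o)).
    by apply: cvgB; [exact: cvg_cst|exact: cvg_id].
  exact: cg.
under [X in radon_integral _ _ X]eq_fun do rewrite inner.
rewrite radon_integral_comb.
  apply: eq_bigr => x _; rewrite mulr_suml; apply: eq_bigr => z _.
  rewrite -mulrA -rmorphM /= [_ * spin R (w x)]mulrC; congr (g _ * _).
  by rewrite /lattice_point /= !intrB.
apply: cmeasurable_sum => z; apply: cmeasurableM; last exact: cmeasurable_cst.
apply: (@continuous_cmeasurable _ (fun x => g (x - pt z : plane))) => x.
apply: (@continuous_comp _ _ _ (fun x : plane => x - pt z : plane) (g : plane -> R[i]^o)).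
  by apply: (@cvgB _ plane); [exact: cvg_id|exact: cvg_cst].
exact: cg.
Qed.

Lemma vol_square (r : R) : 0 <= r -> vol (square r) = (2 * r) ^+ 2.
Proof.
move=> r0.
have L : (@lebesgue_measure R `[(- r)%R, r] = (2 * r)%:E)%E.
  rewrite lebesgue_measure_itv /= lte_fin; case: ltP => [_|rr].
    by rewrite -EFinB; congr (_%:E); lra.
  by congr (_%:E); lra.
rewrite /vol square_setX (_ : lebesgue2 R _ =
    (@lebesgue_measure R `[(- r)%R, r] * @lebesgue_measure R `[(- r)%R, r])%E).
  by rewrite L /= expr2.
exact: product_measure1E.
Qed.

Lemma radon_integral_delta0 (f : plane -> R[i]) :
  cmeasurable setT (f : mplane -> R[i]) ->
  radon_integral (delta0 R) setT f = f (0, 0).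
Proof.
move=> [mRe mIm]; rewrite /radon_integral.
have -> : (fun x => f x * radon_density (delta0 R) x) = f.
  by apply/funext => x /=; rewrite mulr1.
rewrite /cintegral /Rintegral.
have E (h : mplane -> R) : measurable_fun setT h ->
    fine (\int[\d_((0%R, 0%R) : mplane)]_x (h x)%:E)%E = h (0, 0).
  move=> mh; rewrite integral_dirac//; last exact/measurable_EFinP.
  by rewrite diracE mem_set// mul1e.
by rewrite !E//=; case: (f _).
Qed.

(** The support is compact, hence bounded. *)
Lemma test_function_lattice_support (g : plane -> R[i]) : test_function g ->
  exists M, forall z, g (pt z) != 0 -> z \in box M.
Proof.
move=> [_ /(@compact_bounded R plane)[B [_ gB]]].
have [M BM] : exists M : nat, B + 1 <= M%:R.
  exists (Num.bound `|B + 1|); apply/ltW/(le_lt_trans (ler_norm _)).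
  by apply: archi_boundP.
exists M => z gz.
have : `|pt z : plane| <= M%:R.
  apply: le_trans BM; apply: gB; first by rewrite ltrDl.
  exact: subset_closure.
rewrite /Num.norm /= ge_max /= -!intr_norm mem_box.
by rewrite -![M%:R]/(M%:Z%:~R) !ler_int.
Qed.

(** For fixed x, the substitution z = x - p matches the z in the box of radius N
    for which x - z lies in the box of radius M with the p in the box of radius
    M for which x - p lies in the box of radius N. *)
Lemma sum_by_lag (w : configuration) N M (G : int * int -> R[i]) :
  (forall z, G z != 0 -> z \in box M) ->
  \sum_(x <- box N) \sum_(z <- box N)
    G (x - z) * (spin R (w x) * spin R (w z))%:C =
  \sum_(p <- box M) G p * (lag_sum R p N w)%:C.
Proof.
move=> GM; rewrite /lag_sum.
under [RHS]eq_bigr do rewrite rmorph_sum/= big_mkcond mulr_sumr.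
rewrite [RHS]exchange_big; apply: eq_bigr => x _ /=.
transitivity (\sum_(z <- [seq z <- box N | x - z \in box M])
    G (x - z) * (spin R (w x) * spin R (w z))%:C).
  rewrite big_filter [RHS]big_mkcond; apply: eq_bigr => z _.
  case: ifPn => // xz; have [->|/GM] := eqVneq (G (x - z)) 0.
    by rewrite mul0r.
  by rewrite (negbTE xz).
transitivity (\sum_(p <- [seq p <- box M | x - p \in box N])
    G p * (spin R (w x) * spin R (w (x - p)))%:C); last first.
  rewrite big_filter big_mkcond; apply: eq_bigr => p _.
  by case: ifP => //; rewrite mulr0.
under [RHS]eq_bigr => p _ do rewrite -{1}[p](subKr x).
rewrite -(big_map (fun p => x - p) xpredT
  (fun z => G (x - z) * (spin R (w x) * spin R (w z))%:C)) /=.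
apply: perm_big; apply: uniq_perm.
- by rewrite filter_uniq ?uniq_box.
- rewrite map_inj_uniq ?filter_uniq ?uniq_box// => a b /addrI/oppr_inj; exact.
move=> z; rewrite mem_filter; apply/andP/mapP => [[xz zN]|[p + ->]].
  by exists (x - z); rewrite ?mem_filter subKr// zN.
by rewrite mem_filter subKr => /andP[-> ->].
Qed.

Lemma lag_sum0 (w : configuration) N : lag_sum R 0 N w = ((N.*2 + 1) ^ 2)%:R.
Proof.
rewrite /lag_sum -size_box -sum1_size natr_sum.
rewrite big_seq_cond [RHS]big_seq; apply: eq_big => x; first by rewrite subr0 andbb.
by rewrite subr0 /spin -signr_addb addbb.
Qed.

Lemma lag_sum0_cvg (w : configuration) :
  lag_sum R 0 N w / (2 * N%:R) ^+ 2 @[N --> \oo] --> (1 : R).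
Proof.
rewrite -(cvg_shiftS (fun N => lag_sum R 0 N w / (2 * N%:R) ^+ 2)).
rewrite (_ : (fun N => _) = (fun n => (1 + 2^-1 * harmonic n) ^+ 2)).
  have h : (fun n => 1 + 2^-1 * harmonic n : R) @ \oo --> (1 + 2^-1 * 0 : R).
    apply: cvgD; first exact: cvg_cst.
    by apply: cvgM; [exact: cvg_cst|exact: cvg_harmonic].
  have := @cvgM R _ _ eventually_filter _ _ _ _ h h.
  by rewrite mulr0 addr0 mulr1.
apply/funext => n; rewrite lag_sum0 natrX -expr_div_n /harmonic /=; congr (_ ^+ 2).
rewrite natrD -mul2n natrM; field.
by rewrite addrC natr1 pnatr_eq0.
Qed.

Lemma cvg_sum_scaled I (s : seq I) (c : I -> R[i]) (u : I -> R^nat) (l : I -> R) :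
  (forall i, u i @ \oo --> l i) ->
  (fun n => \sum_(i <- s) c i * (u i n)%:C : R[i]^o) @ \oo -->
  (\sum_(i <- s) c i * (l i)%:C : R[i]^o).
Proof.
move=> ul; elim: s => [|i s ih].
  rewrite big_nil; under eq_fun do rewrite big_nil.
  exact: cvg_cst.
rewrite big_cons; under eq_fun do rewrite big_cons.
apply: (@cvgD _ (R[i]^o)); last exact: ih.
apply: (@cvgM (R[i])); first exact: cvg_cst.
by apply: cvg_real_complex; exact: ul.
Qed.

Lemma comb_autocorrelation (w : configuration) :
  (forall p : int * int, p != 0 ->
     lag_sum R p N w / (2 * N%:R) ^+ 2 @[N --> \oo] --> (0 : R)) ->
  is_autocorrelation (dirac_comb R w) (delta0 R).
Proof.
move=> w0 g tg /=; have [cg _] := tg.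
have [M gM] := test_function_lattice_support tg.
rewrite radon_integral_delta0; last exact: continuous_cmeasurable.
rewrite -[(0, 0)]/(pt 0).
have -> : (fun N : nat =>
    convolution (radon_integral (dirac_comb R w) (square N%:R))
      (reflect_conj (radon_integral (dirac_comb R w) (square N%:R))) g /
    (vol (square (R := R) N%:R))%:C) =
  (fun N : nat => \sum_(p <- box M)
     g (pt p) * (lag_sum R p N w / (2 * N%:R) ^+ 2)%:C).
  apply/funext => N; rewrite convolution_comb// vol_square//.
  rewrite (@sum_by_lag w N M (fun p => g (pt p)))// mulr_suml.
  by apply: eq_bigr => p _; rewrite -mulrA -fmorphV -rmorphM.
have -> : g (pt 0) = \sum_(p <- box M) g (pt p) * (p == 0)%:R%:C.
  have [g0|g0] := eqVneq (g (pt 0)) 0.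
    rewrite g0 big1// => p _; case: eqVneq => [->|_]; last by rewrite mulr0.
    by rewrite g0 mul0r.
  rewrite (bigD1_seq 0) ?gM ?uniq_box//= mulr1 big1 ?addr0// => p p0.
  by rewrite (negbTE p0) mulr0.
apply: cvg_sum_scaled => p; have [->|p0] := eqVneq p 0.
  exact: lag_sum0_cvg.
exact: w0.
Qed.

End autocorrelation.

(** * The Fourier transform of the unit mass at the origin *)

Section fourier.
Variable R : realType.
Local Notation plane := (R * R)%type.
Local Notation mplane := (measurableTypeR R * measurableTypeR R)%type.

Lemma measurable_oneDsqrV : measurable_fun setT (fun x : R => (oneDsqr x)^-1).
Proof. exact: continuous_measurable_fun (@continuous_oneDsqrV R). Qed.

Lemma oneDsqrV_ge0 (x : R) : 0 <= (oneDsqr x)^-1.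
Proof. by rewrite invr_ge0 (le_trans ler01)// oneDsqr_ge1. Qed.

Lemma integral_oneDsqrV_lty :
  (\int[@lebesgue_measure R]_x ((oneDsqr x)^-1)%:E < +oo)%E.
Proof.
rewrite (@ge0_symfun_integralT _ (fun x : R => (oneDsqr x)^-1)).
- by rewrite -set_itvcy integral0y_oneDsqr -EFinM ltry.
- exact: oneDsqrV_ge0.
- exact: continuous_oneDsqrV.
- by move=> x /=; rewrite /oneDsqr sqrrN.
Qed.

(** An integrable function on the plane that decays slowly enough to dominate
    every Schwartz function up to a constant. *)
Definition plane_weight (x : mplane) : R := (oneDsqr x.1)^-1 * (oneDsqr x.2)^-1.

Lemma plane_weight_ge0 x : 0 <= plane_weight x.
Proof. by rewrite mulr_ge0 ?oneDsqrV_ge0. Qed.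

Lemma measurable_plane_weight : measurable_fun setT plane_weight.
Proof.
apply: measurable_funM.
  exact: (measurableT_comp measurable_oneDsqrV measurable_fst).
exact: (measurableT_comp measurable_oneDsqrV measurable_snd).
Qed.

Lemma integrable_plane_weight :
  (lebesgue2 R).-integrable setT (fun x => (plane_weight x)%:E).
Proof.
apply/integrable12ltyP.
  by apply/measurable_EFinP; exact: measurable_plane_weight.
have Kfin := integral_oneDsqrV_lty.
set K := (\int[_]_x _)%E in Kfin.
have K0 : (0 <= K)%E by apply: integral_ge0 => x _; rewrite lee_fin oneDsqrV_ge0.
have E x : (\int[@lebesgue_measure R]_y `|(plane_weight (x, y))%:E| =
    ((oneDsqr x)^-1)%:E * K)%E.
  under eq_integral => y _ do
    rewrite gee0_abs ?lee_fin ?plane_weight_ge0// /plane_weight /= EFinM.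
  by rewrite ge0_integralZl//; apply/measurable_EFinP; exact: measurable_oneDsqrV.
under eq_integral do rewrite E.
rewrite ge0_integralZr//; first by rewrite lte_mul_pinfty// ge0_fin_numE.
by apply/measurable_EFinP; exact: measurable_oneDsqrV.
Qed.

Lemma real_schwartz_measurable (f : plane -> R) :
  real_schwartz f -> measurable_fun setT (f : mplane -> R).
Proof.
move=> sf; apply: continuous_plane_measurable => x.
by apply: differentiable_continuous; have [] := sf [::].
Qed.

(** Expanding (1 + x^2) (1 + y^2) shows that |f| (1 + x^2) (1 + y^2) is bounded by
    the sum of the bounds of f, x^2 f, y^2 f and x^2 y^2 f. *)
Lemma real_schwartz_integrable (f : plane -> R) : real_schwartz f ->
  (lebesgue2 R).-integrable setT (fun x => (f x)%:E).
Proof.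
move=> sf; have [_ bf] := sf [::].
have [c00 f00] := bf 0%N 0%N; have [c20 f20] := bf 2%N 0%N.
have [c02 f02] := bf 0%N 2%N; have [c22 f22] := bf 2%N 2%N.
pose c := c00 + c20 + c02 + c22.
apply: (le_integrable measurableT (g := fun x => (c%:E * (plane_weight x)%:E)%E)).
- by apply/measurable_EFinP; exact: real_schwartz_measurable.
- move=> x _; rewrite -EFinM !abse_EFin lee_fin normrM.
  rewrite [X in _ * X]ger0_norm ?plane_weight_ge0//.
  apply: (@le_trans _ _ (c * plane_weight x)); last first.
    by rewrite ler_wpM2r ?plane_weight_ge0 ?ler_norm.
  rewrite /plane_weight -invfM ler_pdivlMr; last first.
    by rewrite mulr_gt0// (lt_le_trans ltr01)// oneDsqr_ge1.
  have bound i j (e : R) : 0 <= x.1 ^+ i * x.2 ^+ j ->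
      `|x.1 ^+ i * x.2 ^+ j * f x| <= e -> x.1 ^+ i * x.2 ^+ j * `|f x| <= e.
    by move=> ij0; rewrite normrM (ger0_norm ij0).
  have := bound _ _ _ _ (f00 x); have := bound _ _ _ _ (f20 x).
  have := bound _ _ _ _ (f02 x); have := bound _ _ _ _ (f22 x).
  rewrite !expr0 !mul1r !mulr1 ler01 !sqr_ge0 (mulr_ge0 (sqr_ge0 _) (sqr_ge0 _)).
  move=> /(_ isT) h1 /(_ isT) h2 /(_ isT) h3 /(_ isT) h4; move: h1 h2 h3 h4.
  rewrite /oneDsqr /c; move: (`|f x|) (x.1 ^+ 2) (x.2 ^+ 2) => n a b h1 h2 h3 h4.
  rewrite (_ : n * _ = a * b * n + b * n + a * n + n); last by ring.
  lra.
- exact: (integrableZl measurableT c integrable_plane_weight).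
Qed.

(** Tonelli's theorem gives this for the positive and negative parts of F, with
    the integral over the plane written as an iterated integral over the line,
    one variable at a time. *)
Lemma measurable_parameter_integral (F : mplane * mplane -> R) :
  measurable_fun setT F ->
  measurable_fun setT (fun k => Rintegral (lebesgue2 R) setT (fun x => F (k, x))).
Proof.
move=> mF; apply: (measurableT_comp (fine_measurable measurableT)).
under eq_fun do rewrite integralE.
have mEF : measurable_fun setT (EFin \o F) by exact/measurable_EFinP.
have mpart (G : mplane * mplane -> \bar R) : measurable_fun setT G ->
    (forall z, 0 <= G z)%E ->
    measurable_fun setT (fun k => \int[lebesgue2 R]_x G (k, x))%E.
  move=> mG G0.
  pose H (kx : mplane * measurableTypeR R) : \bar R :=
    (\int[@lebesgue_measure R]_y G (kx.1, (kx.2, y)))%E.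
  have mH : measurable_fun setT H.
    pose G' (z : (mplane * measurableTypeR R) * measurableTypeR R) : \bar R :=
      G (z.1.1, (z.1.2, z.2)).
    have mG' : measurable_fun setT G'.
      apply: (measurableT_comp mG); apply: measurable_fun_pair.
        exact: (measurableT_comp measurable_fst measurable_fst).
      apply: measurable_fun_pair; last exact: measurable_snd.
      exact: (measurableT_comp measurable_snd measurable_fst).
    exact: (@measurable_fun_fubini_tonelli_F _ _ _ _ _ (@lebesgue_measure R) _ mG'
      (fun z => G0 (z.1.1, (z.1.2, z.2)))).
  have H0 kx : (0 <= H kx)%E by apply: integral_ge0 => y _; exact: G0.
  rewrite (_ : (fun k => _) = fubini_F (@lebesgue_measure R) H).
    exact: (@measurable_fun_fubini_tonelli_F _ _ _ _ _ (@lebesgue_measure R) _ mH H0).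
  apply/funext => k; rewrite /lebesgue2 /=.
  rewrite (@fubini_tonelli1 _ _ _ _ _ _ _ (fun x => G (k, x)))//.
  by apply: (measurableT_comp mG); exact: measurable_fun_pair.
apply: emeasurable_funB.
  under eq_fun do under eq_integral do rewrite funeposE.
  apply: (mpart (fun z => maxe (F z)%:E 0%E)); last first.
    by move=> z; rewrite le_max lexx orbT.
  by apply: measurable_maxe => //; exact: measurable_cst.
under eq_fun do under eq_integral do rewrite funenegE.
apply: (mpart (fun z => maxe (- (F z)%:E)%E 0%E)); last first.
  by move=> z; rewrite le_max lexx orbT.
by apply: measurable_maxe => //; exact: measurableT_comp.
Qed.

Lemma schwartz_cmeasurable (phi : plane -> R[i]) :
  schwartz phi -> cmeasurable setT (phi : mplane -> R[i]).
Proof. by move=> [sRe sIm]; split; exact: real_schwartz_measurable. Qed.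

Lemma cmeasurable_fourier (phi : plane -> R[i]) :
  cmeasurable setT (phi : mplane -> R[i]) ->
  cmeasurable setT (fourier phi : mplane -> R[i]).
Proof.
move=> mphi.
pose t (z : mplane * mplane) : R := 2 * pi * (z.1.1 * z.2.1 + z.1.2 * z.2.2).
have mt : measurable_fun setT t.
  apply: measurable_funM => //; apply: measurable_funD; apply: measurable_funM.
  - exact: (measurableT_comp measurable_fst measurable_fst).
  - exact: (measurableT_comp measurable_fst measurable_snd).
  - exact: (measurableT_comp measurable_snd measurable_fst).
  - exact: (measurableT_comp measurable_snd measurable_snd).
pose H (z : mplane * mplane) : R[i] := (cos (t z) -i* sin (t z)) * phi z.2.
have [mRe mIm] : cmeasurable setT H.
  apply: cmeasurableM.
    split => /=.
      exact: (measurableT_comp (continuous_measurable_fun (@continuous_cos R)) mt).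
    rewrite (_ : _ \o _ = \- (@sin R \o t)); last by apply/funext.
    apply: measurableT_comp => //.
    exact: (measurableT_comp (continuous_measurable_fun (@continuous_sin R)) mt).
  by case: mphi => mRe mIm; split; [exact: (measurableT_comp mRe measurable_snd)
                                   |exact: (measurableT_comp mIm measurable_snd)].
split; [exact: (measurable_parameter_integral mRe)
       |exact: (measurable_parameter_integral mIm)].
Qed.

Lemma fourier0 (phi : plane -> R[i]) :
  fourier phi (0, 0) = cintegral (lebesgue2 R) setT phi.
Proof.
rewrite /fourier; congr cintegral; apply/funext => x /=.
by rewrite !mul0r addr0 mulr0 cos0 sin0 oppr0 mul1r.
Qed.

Lemma cintegrable_dirac0 (f : mplane -> R[i]) : cmeasurable setT f ->
  cintegrable (\d_((0, 0) : mplane) : {measure set mplane -> \bar R}) setT f.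
Proof.
have E (h : mplane -> R) : measurable_fun setT h ->
    (\d_((0%R, 0%R) : mplane)).-integrable setT (EFin \o h).
  move=> mh; have mEh : measurable_fun setT (EFin \o h) by exact/measurable_EFinP.
  apply/integrableP; split => //.
  by rewrite integral_dirac ?diracE ?mem_set ?mul1e ?ltry//; exact: measurableT_comp.
by move=> [mRe mIm]; split; exact: E.
Qed.

Lemma fourier_delta0 : is_fourier_transform (delta0 R) (lebesgue_radon R).
Proof.
move=> phi sphi; have mphi := schwartz_cmeasurable sphi.
have mF := cmeasurable_fourier mphi; split.
- apply: cintegrable_dirac0; apply: cmeasurableM => //; exact: cmeasurable_cst.
- rewrite /radon_integrable (_ : (fun x => _) = phi).
    by case: sphi => sRe sIm; split; exact: real_schwartz_integrable.
  by apply/funext => x; rewrite mulr1.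
- rewrite radon_integral_delta0// fourier0 /radon_integral; congr cintegral.
  by apply/funext => x /=; rewrite mulr1.
Qed.

End fourier.

(** * Almost sure diffraction of the Ledrappier shift *)

Theorem theorem4 (R : realType) (mu : probability (borel ledrappier) R)
    (mu_haar : is_haar mu) :
  {ae mu, forall w : borel ledrappier,
    is_autocorrelation (dirac_comb R (set_val (w : ledrappier))) (delta0 R) /\
    is_diffraction (dirac_comb R (set_val (w : ledrappier))) (lebesgue_radon R)}.
Proof.
have := ae_lag_sum_cvg0 mu_haar; apply: filterS => w w0.
have autocorr := comb_autocorrelation w0; split=> //.
by exists (delta0 R); split=> //; exact: fourier_delta0.
Qed.
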